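(* Let $n\ge1$ and $0\le\overline{s}\le n-1$ be integers and let $k=n$. Define $(\mathbf{A}_\sigma,\mathbf{B}_\sigma)$, $\sigma=0,\dots,\overline{s}$, by the following algorithm: set $\mathbf{B}_0=\mathbf{I}_{n\times k}$ and $\mathbf{A}_0=\mathbf{1}_{1\times n}$; for $\sigma=1,\dots,\overline{s}$ set $\mathbf{B}_\sigma=\texttt{determineCoef}(n,\sigma)$ and $\mathbf{A}_\sigma=\texttt{findDecoding}(\mathbf{B}_\sigma,\sigma)$, with the subroutines as described in the context; return $\{(\mathbf{A}_\sigma,\mathbf{B}_\sigma):\sigma=0,\dots,\overline{s}\}$. This algorithm generates an $(n,k,\overline{s})$ nested gradient code.
   Context: For a vector $\mathbf{z}$, $\operatorname{supp}(\mathbf{z})$ is the set of indices of its nonzero entries and $\|\mathbf{z}\|_0=|\operatorname{supp}(\mathbf{z})|$. $\mathbf{1}_{a\times b}$ is the $a\times b$ all-ones matrix, $\mathbf{I}_{n\times k}$ with $k=n$ is the identity. Gradient code. An $(n,k,\sigma)$ gradient code is a pair $(\mathbf{A}_\sigma,\mathbf{B}_\sigma)$ of real matrices such that: (1) $\mathbf{A}_\sigma\in\mathbb{R}^{\binom{n}{\sigma}\times n}$ and $\mathbf{B}_\sigma\in\mathbb{R}^{n\times k}$; (2) every $n-\sigma$ rows of $\mathbf{B}_\sigma$ span an $(n-\sigma)$-dimensional subspace containing $\mathbf{1}_{1\times k}$; (3) every row $\mathbf{b}_j$ of $\mathbf{B}_\sigma$ satisfies $\|\mathbf{b}_j\|_0\ge\frac{k}{n}(\sigma+1)$;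 (4) for every subset $\mathcal{N}\subseteq\{1,\dots,n\}$ of size $n-\sigma$ there is a row $\mathbf{a}$ of $\mathbf{A}_\sigma$ with $\operatorname{supp}(\mathbf{a})\subseteq\mathcal{N}$; (5) $\mathbf{A}_\sigma\mathbf{B}_\sigma=\mathbf{1}_{\binom{n}{\sigma}\times k}$. Nested gradient code. An $(n,k,\overline{s})$ nested gradient code is a family $\{(\mathbf{A}_\sigma,\mathbf{B}_\sigma):\sigma=0,\dots,\overline{s}\}$ such that each $(\mathbf{A}_\sigma,\mathbf{B}_\sigma)$ is an $(n,k,\sigma)$ gradient code and, for every $\sigma<\overline{s}$ and every $i\in\{1,\dots,n\}$, the $i$-th rows $\mathbf{b}_\sigma^{(i)}$ of $\mathbf{B}_\sigma$ and $\mathbf{b}_{\sigma+1}^{(i)}$ of $\mathbf{B}_{\sigma+1}$ satisfy $\operatorname{supp}(\mathbf{b}_\sigma^{(i)})\subseteq\operatorname{supp}(\mathbf{b}_{\sigma+1}^{(i)})$. Both subroutines are those of Tandon et al., ''Gradient Coding'' (2017). Subroutine $\texttt{determineCoef}(n,\sigma)$ (for $1\le\sigma\le n-1$), which constructs an encoding matrix with cyclic repetition support structure: draw a random matrix $\mathbf{H}\in\mathbb{R}^{\sigma\times n}$ whose first $n-1$ columns have i.i.d. standard normal entries, and whose last column is minus the sum of the first $n-1$ columns. For each $i\in\{1,\dots,n\}$ let $j_1,j_2,\dots,j_{\sigma+1}$ be the indices $i,i+1,\dots,i+\sigma$ taken cyclically modulo $n$ in $\{1,\dots,n\}$. The $i$-th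 row of the output $\mathbf{B}\in\mathbb{R}^{n\times n}$ has entry $1$ in position $j_1$, has entries in positions $j_2,\dots,j_{\sigma+1}$ given by the vector $-\mathbf{H}_{\{j_2,\dots,j_{\sigma+1}\}}^{-1}\mathbf{H}_{j_1}$ (where $\mathbf{H}_{\{j_2,\dots,j_{\sigma+1}\}}$ is the $\sigma\times\sigma$ matrix of columns $j_2,\dots,j_{\sigma+1}$ of $\mathbf{H}$ in this order and $\mathbf{H}_{j_1}$ is column $j_1$), and is $0$ elsewhere. Subroutine $\texttt{findDecoding}(\mathbf{B},\sigma)$, which constructs the corresponding decoding matrix: for each subset $I\subseteq\{1,\dots,n\}$ of size $n-\sigma$, solve $\mathbf{x}\,\mathbf{B}_I=\mathbf{1}_{1\times k}$ for a row vector $\mathbf{x}$ (where $\mathbf{B}_I$ consists of the rows of $\mathbf{B}$ indexed by $I$), and form the row vector $\mathbf{a}\in\mathbb{R}^{1\times n}$ that equals $\mathbf{x}$ on the positions in $I$ and is $0$ elsewhere; the output $\mathbf{A}$ is the $\binom{n}{\sigma}\times n$ matrix of all these rows. *)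

(* Defs.v *)
(* MathComp / MathComp-Analysis *)
From HB Require Import structures.
From mathcomp Require Import all_boot all_order all_algebra.
From mathcomp Require Import all_classical all_reals all_analysis.

Set Implicit Arguments.
Unset Strict Implicit.
Unset Printing Implicit Defensive.

Import Order.TTheory GRing.Theory Num.Theory.

Local Open Scope ring_scope.

(* The indices 1, ..., n are encoded from 0, as elements of 'I_n. *)

Definition supp (R : realType) (n : nat) (z : 'rV[R]_n) : {set 'I_n} :=
  [set j | z 0 j != 0].

Definition norm0 (R : realType) (n : nat) (z : 'rV[R]_n) : nat := #|supp z|.

(* B_I: the rows of B with index in I, in increasing order. *)
Definition rows_of (R : realType) (n k : nat) (B : 'M[R]_(n, k))
    (I : {set 'I_n}) : 'M[R]_(#|I|, k) :=
  rowsub (fun t : 'I_#|I| => enum_val t) B.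

Definition gradient_code (R : realType) (n k sigma : nat)
    (A : 'M[R]_('C(n, sigma), n)) (B : 'M[R]_(n, k)) : Prop :=
  [/\ forall I : {set 'I_n}, #|I| = (n - sigma)%N ->
        \rank (rows_of B I) = (n - sigma)%N /\
        ((const_mx 1 : 'rV[R]_k) <= rows_of B I)%MS,
      forall j : 'I_n,
        k%:R / n%:R * (sigma + 1)%:R <= (norm0 (row j B))%:R :> R,
      forall N : {set 'I_n}, #|N| = (n - sigma)%N ->
        exists r : 'I_('C(n, sigma)), supp (row r A) \subset N
    & A *m B = const_mx 1].

(* Only the members of the families with index sigma <= s are meaningful. *)
Definition nested_gradient_code (R : realType) (n k s : nat)
    (A : forall sigma : nat, 'M[R]_('C(n, sigma), n))
    (B : nat -> 'M[R]_(n, k)) : Prop :=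
  (forall sigma : nat, (sigma <= s)%N -> gradient_code (A sigma) (B sigma)) /\
  (forall sigma : nat, (sigma < s)%N -> forall i : 'I_n,
     supp (row i (B sigma)) \subset supp (row i (B sigma.+1))).

(* The matrix with first n - 1 columns G and last column minus their sum:
   insub j is Some j' exactly when j < n - 1. *)
Definition zero_sum_completion (R : realType) (m n : nat)
    (G : 'M[R]_(m, n.-1)) : 'M[R]_(m, n) :=
  \matrix_(i, j)
    (if (insub (val j) : option 'I_n.-1) is Some j' then G i j'
     else - \sum_j' G i j').

(* cyc i t is i + t modulo n. *)
Definition cyc (n : nat) (i : 'I_n) (t : nat) : 'I_n := iter t (@ordS n) i.

(* The subroutines are relations between input and output: determineCoef has
   no output when one of the matrices to be inverted is singular, and
   findDecoding has none when one of the linear systems has no solution, and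
   possibly several ones otherwise. *)

Definition determineCoef (R : realType) (n sigma : nat)
    (H : 'M[R]_(sigma, n)) (B : 'M[R]_n) : Prop :=
  forall i : 'I_n,
    let Hsub := colsub (fun t : 'I_sigma => cyc i t.+1) H in
    [/\ Hsub \in unitmx,
        B i i = 1,
        forall t : 'I_sigma, B i (cyc i t.+1) = (- (invmx Hsub *m col i H)) t 0
      & forall j : 'I_n, (forall t : nat, (t <= sigma)%N -> j != cyc i t) ->
          B i j = 0].

(* The order of the rows of A is arbitrary: I is any enumeration of the
   subsets of size n - sigma. *)
Definition findDecoding (R : realType) (n k sigma : nat)
    (B : 'M[R]_(n, k)) (A : 'M[R]_('C(n, sigma), n)) : Prop :=
  exists I : 'I_('C(n, sigma)) -> {set 'I_n},
    [/\ injective I,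
        forall N : {set 'I_n}, #|N| = (n - sigma)%N <-> exists r, I r = N
      & forall r, exists x : 'rV[R]_#|I r|,
          [/\ x *m rows_of B (I r) = const_mx 1,
              forall t : 'I_#|I r|, A r (enum_val t) = x 0 t
            & forall j : 'I_n, j \notin I r -> A r j = 0]].

(* H sigma is the matrix drawn in the call determineCoef(n, sigma). *)
Definition algorithm_output (R : realType) (n s : nat)
    (H : forall sigma : nat, 'M[R]_(sigma, n))
    (A : forall sigma : nat, 'M[R]_('C(n, sigma), n))
    (B : nat -> 'M[R]_n) : Prop :=
  [/\ B 0%N = 1%:M,
      A 0%N = const_mx 1
    & forall sigma : nat, (1 <= sigma <= s)%N ->
        determineCoef (H sigma) (B sigma) /\
        findDecoding (B sigma) (A sigma)].

Definition mutually_independent (d : measure_display) (T : measurableType d)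
    (R : realType) (P : probability T R) (I : finType)
    (X : I -> {RV P >-> R}) : Prop :=
  forall (J : {set I}) (E : I -> set R), (forall i, measurable (E i)) ->
    P [set w | forall i, i \in J -> E i (X i w)]%classic =
    (\prod_(i in J) P (X i @^-1` E i)%classic)%E.

Definition iid_standard_normal (d : measure_display) (T : measurableType d)
    (R : realType) (P : probability T R) (I : finType)
    (X : I -> {RV P >-> R}) : Prop :=
  mutually_independent X /\
  forall (i : I) (E : set R), measurable E ->
    distribution P (X i) E = normal_prob 0 1 E.

(* Main.v *)
(* For k = n the rows of B_sigma lie in the kernel of H, which has dimension
   n - sigma and contains the all-ones vector.  Hence everything follows once
   (a) any sigma columns of H are independent: then the windows are invertible
   and row i of B_sigma has support exactly {i, ..., i + sigma}, so that the
   supports are nested; and (b) any n - sigma rows of B_sigma are independent: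
   then they span the kernel of H.

   Both (a) and (b) say that certain matrices whose entries are polynomials in
   the independent normal entries have full rank, after the denominators of
   B_sigma are cleared.  A polynomial that does not vanish identically is almost
   surely nonzero: replace the coordinates of a nonvanishing point by the random
   variables one at a time; each time only finitely many values are excluded and
   Fubini applies.

   It remains to find one point where (a) and (b) hold.  It may be complex, as
   a polynomial vanishing at all integer points vanishes at all complex ones.
   Take H with entries w^(j (r + 1)) for a primitive n-th root of unity w.  Then
   (a) is a Vandermonde determinant.  Row i of B_sigma, read from position i on
   as the coefficients of a polynomial of degree sigma, vanishes exactly at
   w, ..., w^sigma, so that its values at the other powers of w are nonzero; up
   to invertible diagonal factors these values again form a Vandermonde matrix,
   which gives (b). *)
Require Import Defs.
From HB Require Import structures.
From mathcomp Require Import all_boot all_order all_algebra algC cyclotomic.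
From mathcomp Require Import all_classical all_reals all_analysis.
From mathcomp Require Import measurable_realfun.

Set Implicit Arguments.
Unset Strict Implicit.
Unset Printing Implicit Defensive.

Import Order.TTheory GRing.Theory Num.Theory.

Local Open Scope ring_scope.

(** * Polynomial functions of independent atomless random variables *)

(** Polynomials in several variables enter only as functions. Induction on this predicate yields
    what the probabilistic argument uses: measurability, and polynomiality in each single
    coordinate. *)
Inductive polyfun (K : comNzRingType) (I : finType) : ((I -> K) -> K) -> Prop :=
| polyfun_const c : polyfun (fun=> c)
| polyfun_var i : polyfun (fun x => x i)
| polyfun_add f g : polyfun f -> polyfun g -> polyfun (fun x => f x + g x)
| polyfun_mul f g : polyfun f -> polyfun g -> polyfun (fun x => f x * g x).

Definition update (I : eqType) (K : Type) (x : I -> K) (i : I) (t : K) : I -> K :=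
  fun j => if j == i then t else x j.

Section Polyfun.
Context (K : comNzRingType) (I : finType).
Implicit Types (f g : (I -> K) -> K).

Lemma polyfun_ext f g : f =1 g -> polyfun f -> polyfun g.
Proof. by move=> /funext ->. Qed.

Lemma polyfun_sum (J : Type) (r : seq J) (Q : pred J) (f : J -> (I -> K) -> K) :
  (forall j, Q j -> polyfun (f j)) ->
  polyfun (fun x => \sum_(j <- r | Q j) f j x).
Proof.
move=> pf; elim: r => [|j r IHr].
  by apply: polyfun_ext (polyfun_const I 0) => x; rewrite big_nil.
case: (boolP (Q j)) => Qj.
  apply: polyfun_ext (polyfun_add (pf j Qj) IHr) => x.
  by rewrite big_cons Qj.
by apply: polyfun_ext IHr => x; rewrite big_cons (negPf Qj).
Qed.

Lemma polyfun_prod (J : Type) (r : seq J) (f : J -> (I -> K) -> K) :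
  (forall j, polyfun (f j)) -> polyfun (fun x => \prod_(j <- r) f j x).
Proof.
move=> pf; elim: r => [|j r IHr].
  by apply: polyfun_ext (polyfun_const I 1) => x; rewrite big_nil.
by apply: polyfun_ext (polyfun_mul (pf j) IHr) => x; rewrite big_cons.
Qed.

Lemma polyfun_opp f : polyfun f -> polyfun (fun x => - f x).
Proof.
move=> pf; apply: polyfun_ext (polyfun_mul (polyfun_const I (-1)) pf) => x.
by rewrite mulN1r.
Qed.

Definition polymx m n (M : (I -> K) -> 'M[K]_(m, n)) : Prop :=
  forall i j, polyfun (fun x => M x i j).

Lemma polyfun_det n (M : (I -> K) -> 'M[K]_n) :
  polymx M -> polyfun (fun x => \det (M x)).
Proof.
move=> pM; apply: polyfun_sum => s _.
by apply: polyfun_mul; [exact: polyfun_const | exact: polyfun_prod].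
Qed.

Lemma polymx_mxsub m n p q (M : (I -> K) -> 'M[K]_(m, n))
    (f : 'I_p -> 'I_m) (g : 'I_q -> 'I_n) :
  polymx M -> polymx (fun x => mxsub f g (M x)).
Proof. by move=> pM i j; apply: polyfun_ext (pM (f i) (g j)) => x; rewrite mxE. Qed.

Lemma polymx_adj n (M : (I -> K) -> 'M[K]_n) :
  polymx M -> polymx (fun x => \adj (M x)).
Proof.
move=> pM i j.
have pc : polyfun (fun x => (-1) ^+ (j + i) * \det (row' j (col' i (M x)))).
  apply: polyfun_mul; first exact: polyfun_const.
  by apply: polyfun_det => k l; apply: polyfun_ext (pM (lift j k) (lift i l)) => x;
    rewrite !mxE.
by apply: polyfun_ext pc => x; rewrite mxE.
Qed.

Lemma polymx_mul m n p (M : (I -> K) -> 'M[K]_(m, n)) (N : (I -> K) -> 'M[K]_(n, p)) :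
  polymx M -> polymx N -> polymx (fun x => M x *m N x).
Proof.
move=> pM pN i j.
have pc : polyfun (fun x => \sum_k M x i k * N x k j).
  by apply: polyfun_sum => k _; exact: polyfun_mul.
by apply: polyfun_ext pc => x; rewrite mxE.
Qed.

Lemma polyfun_section f x i :
  polyfun f -> exists p : {poly K}, forall t, f (update x i t) = p.[t].
Proof.
elim=> [c|j|{}f g _ [p pE] _ [q qE]|{}f g _ [p pE] _ [q qE]].
- by exists c%:P => t; rewrite hornerC.
- rewrite /update; case: (j == i); first by exists 'X => t; rewrite hornerX.
  by exists (x j)%:P => t; rewrite hornerC.
- by exists (p + q) => t; rewrite pE qE hornerD.
- by exists (p * q) => t; rewrite pE qE hornerM.
Qed.

End Polyfun.

Lemma measurable_polyfun (R : realType) (I : finType) (f : (I -> R) -> R)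
    (d : measure_display) (T : measurableType d) (Z : T -> I -> R) :
  polyfun f -> (forall i, measurable_fun setT (fun w => Z w i)) ->
  measurable_fun setT (fun w => f (Z w)).
Proof.
move=> pf mZ; elim: pf => [c|i|{}f g _ mf _ mg|{}f g _ mf _ mg] //=.
- exact: measurable_funD.
- exact: measurable_funM.
Qed.

Lemma finite_poly_roots (R : idomainType) (p : {poly R}) :
  p != 0 -> finite_set [set t | root p t]%classic.
Proof.
move=> p0; apply: contrapT => /infinite_set_fset -/(_ (size p)) [D Dp].
rewrite leqNgt => /negP; apply; apply: max_poly_roots (finmap.fset_uniq D) => //.
by apply/allP => x xD; exact: Dp.
Qed.

Lemma mxrank_mxsub (F : fieldType) (m n p q : nat) (A : 'M[F]_(m, n))
    (f : 'I_p -> 'I_m) (g : 'I_q -> 'I_n) : (\rank (mxsub f g A) <= \rank A)%N.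
Proof.
rewrite -[A in leqLHS]mul1mx -[1%:M *m A]mulmx1 mxsub_mul -mul_rowsub_mx.
exact: leq_trans (mxrankM_maxl _ _) (mxrankM_maxr _ _).
Qed.

(** Choose independent rows, then independent columns among them. A rank bound thus becomes the
    nonvanishing of one determinant, which is a polynomial in the entries. *)
Lemma exists_minor (F : fieldType) (m n : nat) (A : 'M[F]_(m, n)) :
  exists (f : 'I_(\rank A) -> 'I_m) (g : 'I_(\rank A) -> 'I_n), \det (mxsub f g A) != 0.
Proof.
have fr : row_full (rowsub (maxrankfun A) A)^T.
  by rewrite /row_full mxrank_tr; exact: maxrowsub_free.
exists (maxrankfun A), (fullrankfun fr).
rewrite -unitfE -unitmxE; have := fullrowsub_unit fr.
move: (fullrankfun fr) => g; rewrite -trmx_mxsub unitmx_tr.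
by congr (_ \in unitmx); apply/matrixP => i j; rewrite !mxE.
Qed.

(** * Substituting one independent random variable *)

Section IndependentSubstitution.
Context (R : realType) (d : measure_display) (T : measurableType d).
Context (P : probability T R).

(** Fubini: by independence the joint law of [Y] and [X] is the product of their laws. For almost
    every [y] the polynomial [t -> g (y, t)] is nonzero at [t0], so it has finitely many roots, and
    these carry no mass under the law of [X]. *)
Lemma ae_neq0_independent_subst (d1 : measure_display) (T1 : measurableType d1)
    (Y : {RV P >-> T1}) (X : {RV P >-> R}) (g : T1 * R -> R) (t0 : R) :
  (forall A E, measurable A -> measurable E ->
     P (Y @^-1` A `&` X @^-1` E)%classic =
     (P (Y @^-1` A)%classic * P (X @^-1` E)%classic)%E) ->
  (forall E, finite_set E -> P (X @^-1` E)%classic = 0%E) ->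
  measurable_fun setT g ->
  (forall y, exists p : {poly R}, forall t, g (y, t) = p.[t]) ->
  {ae P, forall w, g (Y w, t0) != 0} ->
  {ae P, forall w, g (Y w, X w) != 0}.
Proof.
move=> indep atomless mg polyg nz0.
pose N := (g @^-1` [set 0])%classic.
have mN : measurable N by rewrite -[N]setTI; exact: mg.
have mJ : measurable_fun setT (fun w => (Y w, X w)).
  by apply: measurable_fun_pair.
have mg0 : measurable_fun setT (fun y => g (y, t0)).
  exact: measurable_fun_pair1.
pose N0 := ((fun y => g (y, t0)) @^-1` [set 0])%classic.
have mN0 : measurable N0.
  by rewrite -[N0]setTI; exact: mg0.
have PN0 : distribution P Y N0 = 0%E.
  apply: (measure_negligible (mu := P)); first exact: measurable_funPTI.
  by apply: negligibleS nz0 => w /= ->; rewrite eqxx.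
pose J : {RV P >-> (T1 * R)%type} :=
  HB.pack (fun w => (Y w, X w)) (isMeasurableFun.Build _ _ _ _ _ mJ).
have uniqJ A E : measurable A -> measurable E ->
    distribution P J (A `*` E)%classic = (distribution P Y A * distribution P X E)%E.
  by move=> mA mE; rewrite -indep.
have JN : distribution P J N = 0%E.
  (* The measure of [N] is the integral of the measures of its sections; the null set [N0] drops out
     of it. *)
  rewrite -(product_measure_unique uniqJ mN) /product_measure1.
  rewrite (ge0_negligible_integral mN0)//; last exact: measurable_fun_xsection.
  apply: integral0_eq => y [_ /eqP gy0] /=; apply: atomless.
  have [p pE] := polyg y.
  have p0 : p != 0 by apply: contraNneq gy0 => p0; rewrite pE p0 horner0.
  apply: sub_finite_set (finite_poly_roots p0) => t.
  by rewrite /xsection /= inE /N /= pE => pt0; apply/rootP.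
exists (J @^-1` N)%classic; split => //.
  exact: measurable_funPTI.
by move=> w /= /negP; rewrite negbK => /eqP.
Qed.

Context (I : finType) (X : I -> {RV P >-> R}) (i : I).

(** A pi-system generating the sigma-algebra of all the [X j] with [j != i]. This sigma-algebra on
    [T] replaces a product sigma-algebra on tuples of values. *)
Definition cylinders : set (set T) :=
  [set A | exists2 E : I -> set R, forall j, measurable (E j) &
    A = [set w | forall j, j != i -> E j (X j w)]]%classic.

Lemma cylinders_measurable : (cylinders `<=` measurable)%classic.
Proof.
move=> _ [E mE ->].
rewrite [X in measurable X](_ : _ =
    (\bigcap_(j in [set j | j != i]) (X j @^-1` E j))%classic); last first.
  by apply/seteqP; split=> w wE j /=; exact: wE.
apply: fin_bigcap_measurable => [|j _]; last exact: measurable_funPTI.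
exact: finite_finset.
Qed.

Lemma cylinders_setI : setI_closed cylinders.
Proof.
move=> _ _ [E mE ->] [F mF ->]; exists (fun j => E j `&` F j)%classic.
  by move=> j; exact: measurableI.
apply/seteqP; split=> w /=.
  by move=> [wE wF] j ji; split; [exact: wE | exact: wF].
by move=> wEF; split=> j ji; case: (wEF j ji).
Qed.

Lemma generated_measurable A : (<<s cylinders >> A -> measurable A)%classic.
Proof. exact: smallest_sub (@sigma_algebra_measurable _ T) cylinders_measurable A. Qed.

(** Both sides are finite measures in [A]; they agree on the pi-system [cylinders], hence on the
    sigma-algebra it generates. *)
Lemma generated_independent A E : mutually_independent X ->
  (<<s cylinders >> A)%classic -> measurable E ->
  P (A `&` X i @^-1` E)%classic = (P A * P (X i @^-1` E)%classic)%E.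
Proof.
move=> indep mA mE.
have mXE : measurable (X i @^-1` E)%classic by exact: measurable_funPTI.
pose p := fine (P (X i @^-1` E)%classic).
have pE : P (X i @^-1` E)%classic = p%:E by rewrite fineK// fin_num_measure.
have p0 : 0 <= p by rewrite fine_ge0.
rewrite [LHS](_ : _ = mrestr P mXE A)// muleC pE.
rewrite [RHS](_ : _ = mscale (NngNum p0) P A)//.
apply: (g_sigma_algebra_measure_unique cylinders cylinders_measurable
  (fun=> setT)) => //.
- by move=> _; exists (fun=> setT) => //; apply/seteqP.
- by rewrite bigcup_const.
- exact: cylinders_setI.
- move=> _ [F mF ->]; rewrite /mrestr/= /mscale/= -[p%:E]pE.
  (* A cylinder cut with the event on [X i] is a rectangle in all variables; mutual independence for
     [I] and for [I] without [i] then gives both sides. *)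
  rewrite [X in P X = _](_ : _ =
      [set w | forall j, j \in [set: I]%SET -> update F i E j (X j w)]%classic); last first.
    apply/seteqP; split=> w /=; rewrite /update.
      by move=> [wF wE] j _; case: eqVneq => [->|/wF].
    move=> wU; split; last by move: (wU i (finset.in_setT i)); rewrite eqxx.
    by move=> j /negPf ji; move: (wU j (finset.in_setT j)); rewrite ji.
  rewrite [X in (_ * P X)%E](_ : _ =
      [set w | forall j, j \in [set~ i]%SET -> F j (X j w)]%classic); last first.
    by apply/seteqP; split=> w /= wF j ji; apply: wF; rewrite ?inE// in ji *.
  rewrite !indep//; last by move=> j; rewrite /update; case: ifP.
  rewrite (bigD1 i) ?finset.inE//= {1}/update eqxx; congr (_ * _)%E.
  apply: eq_big => j; rewrite ?finset.inE//= => ji.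
  by rewrite /update (negPf ji).
- by move=> _ /=; rewrite /mrestr setTI pE ltry.
Qed.

End IndependentSubstitution.

(** * Polynomials and ranks at a random point *)

Section AlmostSurelyNonzero.
Context (R : realType) (d : measure_display) (T : measurableType d).
Context (P : probability T R) (I : finType) (X : I -> {RV P >-> R}).
Hypothesis indep : mutually_independent X.
Hypothesis atomless :
  forall i E, finite_set E -> P (X i @^-1` E)%classic = 0%E.

Lemma measurable_cylinders i j : j != i ->
  measurable_fun [set: g_sigma_algebraType (cylinders X i)] (X j).
Proof.
move=> ji _ E mE; rewrite setTI; apply: sub_sigma_algebra.
exists (fun k => if k == j then E else setT); first by move=> k; case: ifP.
apply/seteqP; split=> w /=; first by move=> wE k _; case: eqVneq => [->|].
by move=> /(_ j ji); rewrite eqxx.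
Qed.

Lemma ae_polyfun_neq0 (f : (I -> R) -> R) (x0 : I -> R) :
  polyfun f -> f x0 != 0 -> {ae P, forall w, f (fun i => X i w) != 0}.
Proof.
move=> pf fx0.
(* [Z s] takes the random values on [s] and those of [x0] elsewhere; induction on [s] leads from
   [x0] to the random point. *)
pose Z (s : seq I) (w : T) j := if j \in s then X j w else x0 j.
suff aeZ s : {ae P, forall w, f (Z s w) != 0}.
  apply: filterS (aeZ (enum I)) => w; congr (f _ != 0).
  by apply: funext => j; rewrite /Z mem_enum.
elim: s => [|i s IHs].
  by apply: aeW => w; congr (f _ != 0): fx0; apply: funext.
have [si|nsi] := boolP (i \in s).
  apply: filterS IHs => w; congr (f _ != 0); apply: funext => j.
  by rewrite /Z in_cons; case: eqVneq => [->|//]; rewrite si.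
(* [Y] is the identity of [T], seen with the coarser sigma-algebra of the [X j], [j != i]. Since [g]
   overwrites coordinate [i], its first argument enters only through these variables. *)
pose T1 := g_sigma_algebraType (cylinders X i).
have mY : measurable_fun setT (id : T -> T1).
  by move=> _ A mA; rewrite setTI; exact: generated_measurable mA.
pose Y : {RV P >-> T1} := HB.pack (id : T -> T1) (isMeasurableFun.Build _ _ _ _ _ mY).
pose g (yt : T1 * R) := f (update (Z s yt.1) i yt.2).
have mg : measurable_fun setT g.
  apply: measurable_polyfun pf _ => j; rewrite /update.
  have [ji|ji] := eqVneq j i; first exact: measurable_snd.
  rewrite /Z; case: (j \in s) => //.
  apply: (@measurableT_comp _ _ _ _ _ _ (X j : T1 -> R)) => //.
  exact: measurable_cylinders.
have updZ w : update (Z s w) i (x0 i) = Z s w.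
  by apply: funext => j; rewrite /update /Z; case: eqVneq => [->|//]; rewrite (negPf nsi).
have updZX w : update (Z s w) i (X i w) = Z (i :: s) w.
  by apply: funext => j; rewrite /update /Z in_cons; case: eqVneq => [->|].
suff : {ae P, forall w, g (Y w, X i w) != 0}.
  by apply: filterS => w; rewrite /g/= updZX.
apply: (@ae_neq0_independent_subst _ _ _ P _ T1 Y (X i) g (x0 i)) => //.
- by move=> A E mA mE; exact: generated_independent.
- exact: atomless.
- by move=> w; exact: (polyfun_section (Z s w) i pf).
- by apply: filterS IHs => w; rewrite /g/= updZ.
Qed.

Lemma ae_rank_ge (m n r : nat) (M : (I -> R) -> 'M[R]_(m, n)) (x0 : I -> R) :
  polymx M -> (r <= \rank (M x0))%N ->
  {ae P, forall w, (r <= \rank (M (fun i => X i w)))%N}.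
Proof.
move=> pM rM.
have [f [g fg]] := exists_minor (M x0).
apply: filterS (ae_polyfun_neq0 (polyfun_det (polymx_mxsub f g pM)) fg) => w nz.
apply: leq_trans rM _; rewrite -[leqLHS](mxrank_unit (A := mxsub f g (M (fun i => X i w)))).
  exact: mxrank_mxsub.
by rewrite unitmxE unitfE.
Qed.

End AlmostSurelyNonzero.

(** * Cyclic encoding matrices *)

Lemma val_cyc n (i : 'I_n) t : val (cyc i t) = ((i + t) %% n)%N.
Proof.
rewrite /cyc; elim: t => [|t IHt] /=; first by rewrite addn0 modn_small.
by rewrite IHt -addn1 modnDml -addnA addn1.
Qed.

Lemma cyc_inj n (i : 'I_n) t t' :
  (t < n)%N -> (t' < n)%N -> cyc i t = cyc i t' -> t = t'.
Proof.
move=> tn t'n /(congr1 val); rewrite !val_cyc => /eqP.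
by rewrite eqn_modDl !modn_small// => /eqP.
Qed.

(** As [sigma < n], the indices [cyc i t] with [t <= sigma] are pairwise distinct, so none is
    counted twice. *)
Lemma sum_window (V : nmodType) n sigma (i : 'I_n) (f : 'I_n -> V) :
  (sigma < n)%N ->
  (forall j, (forall t, (t <= sigma)%N -> j != cyc i t) -> f j = 0) ->
  \sum_j f j = \sum_(t < sigma.+1) f (cyc i t).
Proof.
move=> sn f0; pose c (t : 'I_sigma.+1) := cyc i t.
rewrite -(big_imset f (h := c) (A := predT)); last first.
  move=> t t' _ _ /cyc_inj e; apply: val_inj; apply: e;
    exact: leq_trans (ltn_ord _) _.
rewrite [LHS](bigID [in c @: predT]) /= [X in _ + X]big1 ?addr0 => [|j jc].
  exact: eq_bigl.
apply: f0 => t ts; apply: contra jc => /eqP ->.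
by apply/imsetP; exists (Ordinal (ts : (t < sigma.+1)%N)).
Qed.

Section Encoding.
Context (F : comUnitRingType) (n sigma : nat).
Implicit Type H : 'M[F]_(sigma, n).

Definition window H (i : 'I_n) : 'M[F]_sigma :=
  colsub (fun t : 'I_sigma => cyc i t.+1) H.

Definition window_coef H (i : 'I_n) (t : 'I_sigma.+1) : F :=
  if unlift ord0 t is Some t' then - (\adj (window H i) *m col i H) t' 0
  else \det (window H i).

(* The rows of determineCoef with denominators cleared, by Cramer's rule. *)
Definition encoding H : 'M[F]_n :=
  \matrix_(i, j) \sum_(t < sigma.+1 | cyc i t == j) window_coef H i t.

Hypothesis sigma_lt_n : (sigma < n)%N.

Lemma encoding_cyc H i (t : 'I_sigma.+1) :
  encoding H i (cyc i t) = window_coef H i t.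
Proof.
rewrite mxE (big_pred1 t)// => t' /=; apply/eqP/eqP => [|-> //] /cyc_inj e.
by apply: val_inj; apply: e; exact: leq_trans (ltn_ord _) _.
Qed.

Lemma encoding_out H i j :
  (forall t, (t <= sigma)%N -> j != cyc i t) -> encoding H i j = 0.
Proof.
move=> jo; rewrite mxE big_pred0// => t; rewrite eq_sym; apply/negbTE.
by apply: jo; rewrite -ltnS.
Qed.

Lemma encoding_diag H i : encoding H i i = \det (window H i).
Proof.
rewrite -[X in encoding H i X]/(cyc i (@ord0 sigma)) encoding_cyc.
by rewrite /window_coef unlift_none.
Qed.

(** A window times its adjugate is its determinant times the identity, so the later coefficients of
    row [i] cancel the determinant times column [i]. *)
Lemma mul_encoding H : H *m (encoding H)^T = 0.
Proof.
apply/matrixP => r i; rewrite mxE [RHS]mxE.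
under eq_bigr do rewrite [X in _ * X]mxE.
rewrite (sum_window (i := i) sigma_lt_n); last first.
  by move=> j jo; rewrite encoding_out// mulr0.
rewrite big_ord_recl encoding_cyc /window_coef unlift_none.
under eq_bigr do rewrite encoding_cyc /window_coef liftK mulrN.
rewrite sumrN.
rewrite -[X in _ - X](_ : (window H i *m (\adj (window H i) *m col i H)) r 0 = _).
  by rewrite mulmxA mul_mx_adj mul_scalar_mx !mxE mulrC subrr.
by rewrite [LHS]mxE; apply: eq_bigr => t _; rewrite mxE.
Qed.

End Encoding.

Lemma map_encoding (F F' : comUnitRingType) (f : {rmorphism F -> F'}) n sigma
    (H : 'M[F]_(sigma, n)) :
  encoding (map_mx f H) = map_mx f (encoding H).
Proof.
apply/matrixP => i j; rewrite !mxE rmorph_sum/=; apply: eq_bigr => t _.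
have wE : window (map_mx f H) i = map_mx f (window H i) by rewrite /window map_mxsub.
rewrite /window_coef wE; case: unlift => [t'|]; last by rewrite det_map_mx.
by rewrite -map_mx_adj -map_col -map_mxM mxE rmorphN.
Qed.

Lemma determineCoef_encoding (R : realType) n sigma (H : 'M[R]_(sigma, n)) B :
  (sigma < n)%N -> determineCoef H B ->
  encoding H = \matrix_(i, j) (\det (window H i) * B i j).
Proof.
move=> sn HB; apply/matrixP => i j; rewrite [RHS]mxE.
have [uH Bii Bit Bout] := HB i; rewrite -/(window H i) in uH Bit.
have [/existsP[t /eqP ->]|nw] := boolP [exists t : 'I_sigma.+1, j == cyc i t].
  rewrite encoding_cyc// /window_coef.
  case: unliftP => [t' ->|->]; last by rewrite /= Bii mulr1.
  rewrite [nat_of_ord _]/= /bump leq0n add1n Bit /invmx uH -scalemxAl !mxE.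
  by rewrite mulrN mulrA divrr ?mul1r// -unitmxE.
have jo t : (t <= sigma)%N -> j != cyc i t.
  move=> ts; apply: contra nw => /eqP jc; apply/existsP.
  by exists (Ordinal (ts : (t < sigma.+1)%N)); rewrite jc.
by rewrite encoding_out// Bout// mulr0.
Qed.

(** * Consequences of (a) and (b) for the encoding matrix *)

Section GoodMatrix.
Context (R : realType) (n sigma : nat) (H : 'M[R]_(sigma, n)).
Hypothesis sigma_lt_n : (sigma < n)%N.

(** Condition (a). A parity-check matrix with this property defines a maximum distance separable
    code, hence the name. *)
Definition mds := forall f : 'I_sigma -> 'I_n, injective f -> colsub f H \in unitmx.

(** Condition (b), stated for [encoding H] because its entries are polynomials in those of [H]. *)
Definition independent_rows := forall I : {set 'I_n}, #|I| = (n - sigma)%N ->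
  (n - sigma <= \rank (rows_of (encoding H) I))%N.

Lemma mds_window i : mds -> window H i \in unitmx.
Proof.
apply => t t' /cyc_inj e; apply: val_inj; apply: succn_inj; apply: e;
  exact: leq_ltn_trans (ltn_ord _) _.
Qed.

Lemma mds_determineCoef : mds -> exists B, determineCoef H B.
Proof.
move=> uH; exists (\matrix_(i, j) ((\det (window H i))^-1 * encoding H i j)) => i.
have uW := mds_window i uH; split => //.
- by rewrite mxE encoding_diag// mulVr// -unitmxE.
- move=> t; rewrite mxE [cyc i t.+1](_ : _ = cyc i (lift ord0 t))//.
  rewrite encoding_cyc// /window_coef liftK -/(window H i) /invmx uW.
  by rewrite -scalemxAl !mxE mulrN.
- by move=> j jo; rewrite mxE encoding_out// mulr0.
Qed.

Context (B : 'M[R]_n).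
Hypotheses (uH : mds) (HB : determineCoef H B).

Lemma mul_determineCoef : H *m B^T = 0.
Proof.
apply/matrixP => r i; rewrite mxE [RHS]mxE.
have dE : \det (window H i) * (\sum_j H r j * B^T j i) = 0.
  have /matrixP/(_ r i) := mul_encoding sigma_lt_n H.
  rewrite (determineCoef_encoding sigma_lt_n HB) mxE [RHS]mxE => E.
  by rewrite mulr_sumr -[RHS]E; apply: eq_bigr => j _; rewrite !mxE mulrCA.
move/eqP: dE; rewrite mulf_eq0 => /orP[/eqP d0|/eqP //].
by have := mds_window i uH; rewrite unitmxE d0 unitr0.
Qed.

(** Row [i] lies in the kernel of [H]. If one of its [sigma + 1] window entries vanished, the other
    [sigma] would be the coefficients of a relation between distinct columns of [H], hence all zero
    by [mds], against [B i i = 1]. *)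
Lemma supp_determineCoef i :
  supp (row i B) = [set cyc i t | t : 'I_sigma.+1].
Proof.
have [_ Bii _ Bout] := HB i.
apply/setP => j; rewrite inE mxE; apply/idP/imsetP => [|[t0 _ ->]].
  apply: contra_neqP => nw; apply: Bout => t ts.
  by apply/eqP => jt; apply: nw; exists (Ordinal (ts : (t < sigma.+1)%N)).
apply/eqP => B0.
pose f (t : 'I_sigma) := cyc i (lift t0 t).
have uf : colsub f H \in unitmx.
  apply: uH => t t' /cyc_inj e; apply: (@lift_inj _ t0); apply: val_inj.
  by apply: e; exact: leq_trans (ltn_ord _) _.
pose v : 'cV[R]_sigma := \col_t B i (f t).
have v0 : v = 0.
  rewrite -[v](mulKmx uf) [X in _ *m X](_ : _ = 0) ?mulmx0//.
  apply/matrixP => r c; rewrite mxE [RHS]mxE.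
  have /matrixP/(_ r i) := mul_determineCoef; rewrite mxE [RHS]mxE => E.
  rewrite -[RHS]E (sum_window (i := i) sigma_lt_n); last first.
    by move=> k ko; rewrite mxE Bout// mulr0.
  rewrite (bigD1_ord t0)//= [X in _ * X]mxE B0 mulr0 add0r.
  by apply: eq_bigr => t _; rewrite !mxE.
case: (unliftP t0 ord0) => [t tE|t0E].
  have /matrixP/(_ t 0) := v0; rewrite !mxE /f -tE /= Bii => /eqP.
  by rewrite oner_eq0.
by move: B0; rewrite -t0E /= Bii => /eqP; rewrite oner_eq0.
Qed.

Lemma card_supp_determineCoef i : #|supp (row i B)| = sigma.+1.
Proof.
rewrite supp_determineCoef card_imset ?card_ord// => t t' /cyc_inj e.
by apply: val_inj; apply: e; exact: leq_trans (ltn_ord _) _.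
Qed.

Hypotheses (H1 : H *m const_mx 1 = 0 :> 'cV[R]_sigma) (indepH : independent_rows).

Lemma rank_rows_determineCoef (I : {set 'I_n}) : #|I| = (n - sigma)%N ->
  \rank (rows_of B I) = (n - sigma)%N.
Proof.
move=> cI; apply/eqP; rewrite eqn_leq -{1}cI rank_leq_row/=.
apply: leq_trans (indepH cI) _.
rewrite (determineCoef_encoding sigma_lt_n HB).
rewrite [X in \rank X](_ : _ =
    diag_mx (\row_t \det (window H (enum_val t))) *m rows_of B I).
  exact: mxrankM_maxr.
by apply/matrixP => t j; rewrite mul_diag_mx !mxE.
Qed.

Lemma rank_mds : \rank H = sigma.
Proof.
apply/eqP; rewrite eqn_leq rank_leq_row /=.
pose f := widen_ord (ltnW sigma_lt_n).
have uf : colsub f H \in unitmx.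
  by apply: uH => t t' /(congr1 val) /= e; apply: val_inj.
rewrite -[leqLHS](mxrank_unit uf) -[H in leqLHS]mulmx1 -mulmx_colsub.
exact: mxrankM_maxl.
Qed.

Lemma ones_rows_determineCoef (I : {set 'I_n}) : #|I| = (n - sigma)%N ->
  ((const_mx 1 : 'rV[R]_n) <= rows_of B I)%MS.
Proof.
move=> cI.
have sB : (rows_of B I <= kermx H^T)%MS.
  apply/sub_kermxP; rewrite mul_rowsub_mx -[B]trmxK -trmx_mul.
  by rewrite mul_determineCoef trmx0 mxsub_const.
(* Both spaces have dimension [n - sigma], so the inclusion is an equality. *)
have := mxrank_leqif_sup sB.
rewrite mxrank_ker mxrank_tr rank_mds rank_rows_determineCoef// => -[_].
rewrite eqxx => /esym; apply: submx_trans.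
apply/sub_kermxP; apply: trmx_inj; rewrite trmx_mul trmxK trmx_const trmx0.
exact: H1.
Qed.

End GoodMatrix.

(** * The example over the roots of unity *)

Lemma Vandermonde_unit (F : fieldType) n (a : 'rV[F]_n) :
  injective (a 0) -> Vandermonde n a \in unitmx.
Proof.
move=> ia; rewrite unitmxE det_Vandermonde unitfE.
apply/prodf_neq0 => i _; apply/prodf_neq0 => j ij.
by rewrite subr_eq0; apply: contraTneq ij => /ia ->; rewrite ltnn.
Qed.

Lemma diag_mx_unit (F : fieldType) n (a : 'rV[F]_n) :
  (forall i, a 0 i != 0) -> diag_mx a \in unitmx.
Proof. by move=> a0; rewrite unitmxE det_diag unitfE; apply/prodf_neq0 => i _. Qed.

Section CyclicExample.
Context (F : fieldType) (n sigma : nat) (w : F).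
Hypotheses (prim_w : n.-primitive_root w) (sigma_lt_n : (sigma < n)%N).

(** The exponents [r.+1] run over 1, ..., [sigma], all nonzero modulo [n], so that every row sums to
    zero as a geometric progression of ratio different from 1. *)
Definition fourier_mx : 'M[F]_(sigma, n) := \matrix_(r, j) w ^+ (j * r.+1).

Let n_gt0 : (0 < n)%N. Proof. exact: prim_order_gt0 prim_w. Qed.

Let w_neq0 k : w ^+ k != 0.
Proof.
apply/negP; rewrite expf_eq0 => /andP[_ /eqP w0]; have := prim_expr_order prim_w.
by rewrite w0 expr0n gtn_eqF// => /eqP; rewrite eq_sym oner_eq0.
Qed.

Let w_inj i j : (i < n)%N -> (j < n)%N -> w ^+ i = w ^+ j -> i = j.
Proof.
move=> ni nj /eqP; rewrite (eq_prim_root_expr prim_w) !modn_small//.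
exact: eqP.
Qed.

Lemma fourier_mx_zero_sum : fourier_mx *m const_mx 1 = 0 :> 'cV_sigma.
Proof.
apply/matrixP => r c; rewrite !mxE.
under eq_bigr do rewrite !mxE mulr1 mulnC exprM.
have /eqP := subrX1 (w ^+ r.+1) n.
rewrite exprAC (prim_expr_order prim_w) expr1n subrr eq_sym mulf_eq0.
case/orP => /eqP // /eqP; rewrite subr_eq0 -[1](expr0 w) => /eqP e.
by have := w_inj (leq_ltn_trans (ltn_ord r) sigma_lt_n) n_gt0 e.
Qed.

Lemma fourier_mx_mds (f : 'I_sigma -> 'I_n) :
  injective f -> colsub f fourier_mx \in unitmx.
Proof.
move=> fi; pose a : 'rV[F]_sigma := \row_t w ^+ f t.
(* Since the exponents start at 1, each column carries an extra factor, collected in the diagonal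
   matrix. *)
have -> : colsub f fourier_mx = Vandermonde sigma a *m diag_mx a.
  by apply/matrixP => r t; rewrite mul_mx_diag !mxE -exprM -exprD mulnS addnC.
rewrite unitmx_mul Vandermonde_unit ?diag_mx_unit//.
  by move=> t; rewrite mxE.
move=> t t'; rewrite !mxE => /(w_inj (ltn_ord _) (ltn_ord _)) e.
by apply: fi; exact: val_inj.
Qed.

Let C i : {poly F} := \poly_(u < sigma.+1) encoding fourier_mx i (cyc i u).

Let w_cyc (v : F) (i : 'I_n) t m : v ^+ n = 1 ->
  v ^+ (cyc i t * m) = v ^+ (i * m) * (v ^+ m) ^+ t.
Proof.
move=> vn; rewrite -(expr_mod (cyc i t * m) vn) [nat_of_ord _]val_cyc modnMml.
by rewrite expr_mod// mulnDl exprD [(t * m)%N]mulnC (exprM _ m t).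
Qed.

(** When row [i] is evaluated at a power of [v], reading it from position [i] on only splits off the
    factor [v ^+ (i * m)]. The case [v = w] gives the zeros of [C i], the case [v = w^-1] the rank
    bound. *)
Let encoding_sum (v : F) i m : v ^+ n = 1 ->
  \sum_j encoding fourier_mx i j * v ^+ (j * m) = v ^+ (i * m) * (C i).[v ^+ m].
Proof.
move=> vn; rewrite (sum_window (i := i) sigma_lt_n); last first.
  by move=> j jo; rewrite encoding_out// mul0r.
rewrite horner_poly mulr_sumr; apply: eq_bigr => t _.
by rewrite w_cyc// mulrCA.
Qed.

Let roots : seq F := [seq w ^+ r.+1 | r <- iota 0 sigma].

(* The zeros of C i, i.e. of row i as a polynomial, do not depend on i: the
   encoding matrix is circulant up to scaling of its rows. *)
Let C_fact i : C i = lead_coef (C i) *: \prod_(x <- roots) ('X - x%:P)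
  /\ lead_coef (C i) != 0.
Proof.
(* The constant coefficient is the determinant of a window, nonzero by [fourier_mx_mds]. *)
have C0 : C i != 0.
  apply/eqP => /(congr1 (fun p : {poly F} => p`_0)); rewrite coef0 coef_poly/=.
  rewrite encoding_diag// => d0.
  suff : window fourier_mx i \in unitmx by rewrite unitmxE d0 unitr0.
  apply: fourier_mx_mds => t t' /cyc_inj e; apply: val_inj; apply: succn_inj;
    apply: e; exact: leq_ltn_trans (ltn_ord _) _.
have rootsC : all (root (C i)) roots.
  apply/allP => x /mapP[r]; rewrite mem_iota add0n => /= rs ->{x}.
  have wn : w ^+ n = 1 := prim_expr_order prim_w.
  have /eqP := encoding_sum i r.+1 wn.
  rewrite [X in X == _](_ : _ = 0) ?(eq_sym 0).
    by rewrite mulf_eq0 (negPf (w_neq0 _)) => /eqP/rootP.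
  have /matrixP/(_ (Ordinal rs) i) := mul_encoding sigma_lt_n fourier_mx.
  rewrite mxE [RHS]mxE => E; rewrite -[RHS]E; apply: eq_bigr => j _.
  by rewrite !mxE mulrC.
have uroots : uniq roots.
  rewrite map_inj_in_uniq ?iota_uniq// => r r'; rewrite !mem_iota !add0n /= => rs rs'.
  move=> e; apply: succn_inj.
  by apply: w_inj e; exact: leq_ltn_trans sigma_lt_n.
(* There are [sigma] distinct roots and at most [sigma + 1] coefficients. *)
have sC : size (C i) = (size roots).+1.
  apply/eqP; rewrite eqn_leq (max_poly_roots C0 rootsC uroots) andbT.
  by rewrite size_map size_iota size_poly.
split; last by rewrite lead_coef_eq0.
by apply: all_roots_prod_XsubC; rewrite ?uniq_rootsE.
Qed.

(** Evaluate the chosen rows at [w ^- m] for [m < n - sigma], the [n]-th roots of unity other than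
    [w], ..., [w ^+ sigma]. As these are consecutive powers of [w^-1] from exponent 0 on, the values
    form a transposed Vandermonde matrix, up to nonzero factors depending on the row alone or on the
    column alone. *)
Lemma rank_encoding_fourier_mx (I : {set 'I_n}) : #|I| = (n - sigma)%N ->
  (n - sigma <= \rank (rowsub (fun t : 'I_#|I| => enum_val t) (encoding fourier_mx)))%N.
Proof.
move=> cI; rewrite -cI; set E := rowsub _ _.
have vn : (w^-1) ^+ n = 1 by rewrite exprVn (prim_expr_order prim_w) invr1.
pose W : 'M[F]_(n, #|I|) := \matrix_(j, m) (w^-1) ^+ (j * m).
suff uEW : E *m W \in unitmx.
  by rewrite -[leqLHS](mxrank_unit uEW); exact: mxrankM_maxl.
pose l : 'rV[F]_#|I| := \row_t lead_coef (C (enum_val t)).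
pose a : 'rV[F]_#|I| := \row_t (w^-1) ^+ val (enum_val t : 'I_n).
pose q : 'rV[F]_#|I| := \row_m (\prod_(x <- roots) ('X - x%:P)).[(w^-1) ^+ m].
have -> : E *m W = diag_mx l *m (Vandermonde #|I| a)^T *m diag_mx q.
  apply/matrixP => t m; rewrite mul_mx_diag mul_diag_mx mxE [RHS]mxE.
  under eq_bigr do rewrite [E _ _]mxE [W _ _]mxE.
  rewrite encoding_sum// (C_fact _).1 hornerZ !mxE exprM.
  by rewrite mulrCA mulrA.
rewrite !unitmx_mul unitmx_tr !diag_mx_unit ?Vandermonde_unit//.
- move=> t t'; rewrite !mxE !exprVn => /invr_inj/(w_inj (ltn_ord _) (ltn_ord _)) e.
  by apply: enum_val_inj; apply: val_inj.
(* A coincidence [w ^- m = w ^+ r.+1] would give [w ^+ (m + r.+1) = 1] with [0 < m + r.+1 < n]. *)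
- move=> m; rewrite mxE -/(root _ _) root_prod_XsubC; apply/mapP => -[r].
  rewrite mem_iota add0n /= exprVn => rs /(congr1 ( *%R (w ^+ m))).
  rewrite divff ?w_neq0// -exprD -[LHS](expr0 w) => e.
  have mr : (m + r.+1 < n)%N.
    have := ltn_ord m; rewrite [X in (_ < X)%N]cI ltn_subRL; apply: leq_ltn_trans.
    by rewrite [(sigma + m)%N]addnC leq_add2l.
  by have := w_inj n_gt0 mr e; rewrite addnS.
- by move=> t; rewrite mxE; case: (C_fact (enum_val t)).
Qed.

End CyclicExample.

(** * From the example to random matrices *)

(** Coordinates are replaced one at a time: 0, ..., [size p - 1] are distinct in characteristic
    zero, so they cannot all be roots of a nonzero [p]. A point with natural coordinates makes sense
    over both [algC] and [R]. *)
Lemma polyfun_nat_point (K : numDomainType) (J : finType) (f : (J -> K) -> K) z :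
  polyfun f -> f z != 0 -> exists x : J -> nat, f (fun j => (x j)%:R) != 0.
Proof.
move=> pf fz; pose Z (s : seq J) (x : J -> nat) j := if j \in s then (x j)%:R else z j.
suff [x fx] : exists x : J -> nat, f (Z (enum J) x) != 0.
  exists x; congr (f _ != 0): fx; apply: funext => j.
  by rewrite /Z mem_enum.
elim: (enum J) => [|i s [x fx]].
  by exists (fun=> 0%N); congr (f _ != 0): fz; apply: funext.
have [si|nsi] := boolP (i \in s).
  exists x; congr (f _ != 0): fx; apply: funext => j.
  by rewrite /Z in_cons; case: eqVneq => [->|//]; rewrite si.
have [p pE] := polyfun_section (Z s x) i pf.
have p0 : p != 0.
  apply: contraNneq fx => p0; have := pE (z i); rewrite p0 horner0 => <-.
  apply/eqP; congr f; apply: funext => j; rewrite /update /Z.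
  by case: eqVneq => [->|//]; rewrite (negPf nsi).
have [m pm] : exists m : nat, p.[m%:R] != 0.
  apply: contrapT => /forallNP roots_p.
  suff : (size [seq k%:R : K | k <- iota 0 (size p)] < size p)%N.
    by rewrite size_map size_iota ltnn.
  apply: max_poly_roots p0 _ _.
    apply/allP => _ /mapP[k _ ->]; apply/rootP/eqP.
    by have /negP := roots_p k; rewrite negbK.
  by rewrite map_inj_uniq ?iota_uniq// => k l /eqP; rewrite eqr_nat => /eqP.
exists (update x i m); move: pm; rewrite -pE; congr (f _ != 0).
by apply: funext => j; rewrite /update /Z in_cons; case: eqVneq.
Qed.

(* [M F x] is a matrix of integer polynomials in [x], made sense of over every
   field: having rank at least [r] at some complex point is inherited by some
   integer point, hence by some point over any field of characteristic zero. *)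
Lemma rank_real_point (R : realType) (J : finType) m n r
    (M : forall F : fieldType, (J -> F) -> 'M[F]_(m, n)) (z : J -> algC) :
  (forall (F F' : fieldType) (f : {rmorphism F -> F'}) x,
     M F' (f \o x) = map_mx f (M F x)) ->
  polymx (M algC) -> (r <= \rank (M algC z))%N ->
  exists x : J -> R, (r <= \rank (M R x))%N.
Proof.
move=> mapM pM rM.
have [f [g fg]] := exists_minor (M algC z).
have [x fgx] := polyfun_nat_point (polyfun_det (polymx_mxsub f g pM)) fg.
exists (fun j => (x j)%:R); apply: leq_trans rM _.
(* At a natural point the matrix is the image of a rational one, and rank is invariant under field
   extension. *)
have rankE (F : numFieldType) : \rank (M F (fun j => (x j)%:R)) =
    \rank (M rat (fun j => (x j)%:R)).
  rewrite -(mxrank_map (ratr : {rmorphism rat -> F})) -mapM; congr (\rank (M F _)).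
  by apply: funext => j; rewrite /= ratr_nat.
rewrite [leqRHS](rankE R) -(rankE algC); apply: leq_trans (mxrank_mxsub _ f g).
by rewrite mxrank_unit// unitmxE unitfE.
Qed.

(* [zero_sum_completion] over an arbitrary ring. *)
Definition completion (F : nzRingType) (m n : nat) (G : 'M[F]_(m, n.-1)) : 'M[F]_(m, n) :=
  \matrix_(i, j)
    (if (insub (val j) : option 'I_n.-1) is Some j' then G i j'
     else - \sum_j' G i j').

Lemma map_completion (F F' : nzRingType) (f : {rmorphism F -> F'}) m n
    (G : 'M[F]_(m, n.-1)) :
  completion (map_mx f G) = map_mx f (completion G) :> 'M[F']_(m, n).
Proof.
apply/matrixP => i j; rewrite !mxE; case: insub => [j'|]; first by rewrite mxE.
by rewrite rmorphN rmorph_sum; congr (- _); apply: eq_bigr => k _; rewrite mxE.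
Qed.

Lemma completion_zero_sum (F : nzRingType) m n (G : 'M[F]_(m, n.-1)) :
  (0 < n)%N -> completion G *m const_mx 1 = 0 :> 'cV_m.
Proof.
case: n G => // n G _; apply/matrixP => i c; rewrite !mxE big_ord_recr/=.
rewrite !mxE mulr1 insubF ?ltnn//; apply/eqP; rewrite subr_eq0; apply/eqP.
by apply: eq_bigr => j _; rewrite !mxE mulr1 /= (valK j).
Qed.

Lemma zero_sum_is_completion (F : nzRingType) m n (H : 'M[F]_(m, n)) (n0 : (0 < n)%N) :
  H *m const_mx 1 = 0 :> 'cV_m ->
  H = completion (colsub (widen_ord (leq_pred n)) H).
Proof.
case: n n0 H => // n _ H /matrixP H1; apply/matrixP => i j; rewrite mxE.
case: insubP => [j' _ j'E|nj]; first by rewrite mxE; congr (H i _); apply: val_inj.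
have -> : j = ord_max.
  by apply: val_inj; apply/eqP; rewrite eqn_leq -ltnS ltn_ord /= leqNgt.
have /eqP := H1 i 0; rewrite !mxE big_ord_recr/= mxE mulr1 addrC addr_eq0 => /eqP ->.
congr (- _); apply: eq_bigr => k _; rewrite !mxE mulr1; congr (H i _).
exact: val_inj.
Qed.

Definition completion_of (F : nzRingType) m n (x : 'I_m * 'I_n.-1 -> F) : 'M[F]_(m, n) :=
  completion (\matrix_(i, j) x (i, j)).

Lemma map_completion_of (F F' : nzRingType) (f : {rmorphism F -> F'}) m n
    (x : 'I_m * 'I_n.-1 -> F) :
  completion_of (f \o x) = map_mx f (completion_of x) :> 'M[F']_(m, n).
Proof.
by rewrite -map_completion; congr completion; apply/matrixP => i j; rewrite !mxE.
Qed.

Lemma polymx_completion_of (K : comNzRingType) m n : polymx (@completion_of K m n).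
Proof.
move=> i j; rewrite /completion_of.
case E : (insub (val j) : option 'I_n.-1) => [j'|].
  have pv := @polyfun_var K ('I_m * 'I_n.-1)%type (i, j').
  by apply: polyfun_ext pv => x; rewrite !mxE E mxE.
have ps : polyfun (fun x : 'I_m * 'I_n.-1 -> K => - \sum_j' x (i, j')).
  by apply: polyfun_opp; apply: polyfun_sum => j' _; exact: polyfun_var.
apply: polyfun_ext ps => x; rewrite mxE E; congr (- _).
by apply: eq_bigr => j' _; rewrite mxE.
Qed.

(** The last column of a zero-sum matrix is forced by the others. Hence the Fourier matrix is a
    value of the same polynomial parametrization as the random matrix. *)
Lemma completion_of_zero_sum (F : nzRingType) m n (H : 'M[F]_(m, n)) :
  (0 < n)%N -> H *m const_mx 1 = 0 :> 'cV_m ->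
  exists x, H = completion_of x.
Proof.
move=> n0 H1; exists (fun ij => H ij.1 (widen_ord (leq_pred n) ij.2)).
by rewrite {1}(zero_sum_is_completion n0 H1); congr completion.
Qed.

Lemma polymx_encoding (K : comUnitRingType) (J : finType) n sigma
    (M : (J -> K) -> 'M[K]_(sigma, n)) :
  polymx M -> polymx (fun x => encoding (M x)).
Proof.
move=> pM i j; rewrite /encoding.
have pc (t : 'I_sigma.+1) : polyfun (fun x => window_coef (M x) i t).
  have pW : polymx (fun x => window (M x) i) by exact: polymx_mxsub.
  rewrite /window_coef; case: unlift => [t'|]; last exact: polyfun_det.
  have pAH := polymx_mul (polymx_adj pW) (polymx_mxsub id (fun _ : 'I_1 => i) pM).
  apply: polyfun_ext (polyfun_opp (pAH t' 0)) => x.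
  congr (- (_ *m _) _ _); by apply/matrixP => k l; rewrite !mxE.
have ps : polyfun (fun x => \sum_(t < sigma.+1 | cyc i t == j) window_coef (M x) i t).
  by apply: polyfun_sum.
by apply: polyfun_ext ps => x; rewrite mxE.
Qed.

(** The normal law is absolutely continuous with respect to Lebesgue measure. *)
Lemma normal_prob_finite (R : realType) (E : set R) :
  finite_set E -> normal_prob 0 1 E = 0%E.
Proof.
move=> fE; have cE := finite_set_countable fE.
apply: (null_content_dominatesP _ _).1 (normal_prob_dominates 0 1) _ _ _.
  exact: countable_measurable.
exact: countable_lebesgue_measure0.
Qed.

(** * Almost sure validity of (a) and (b) *)

Section AlmostSurelyGood.
Context (R : realType) (d : measure_display) (T : measurableType d).
Context (P : probability T R) (n sigma : nat).
Context (G : 'I_sigma * 'I_n.-1 -> {RV P >-> R}).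
Hypotheses (sigma_lt_n : (sigma < n)%N) (iidG : iid_standard_normal G).

Let H (w : T) : 'M[R]_(sigma, n) :=
  zero_sum_completion (\matrix_(i, j) G (i, j) w).

(** The transfer used for both (a) and (b): a rank bound at the complex Fourier matrix passes to
    some real point by [rank_real_point], then to almost every draw by [ae_rank_ge]. [M] ranges over
    all fields so that the same formula can be evaluated over [algC], [rat] and [R]. *)
Lemma ae_completion_rank p q r (M : forall F : fieldType, 'M[F]_(sigma, n) -> 'M[F]_(p, q)) :
  (forall (F F' : fieldType) (f : {rmorphism F -> F'}) A,
     M F' (map_mx f A) = map_mx f (M F A)) ->
  (forall F : fieldType, polymx (fun x => M F (completion_of x))) ->
  (forall (F : fieldType) (w : F), n.-primitive_root w ->
     (r <= \rank (M F (fourier_mx n sigma w)))%N) ->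
  {ae P, forall w, (r <= \rank (M R (H w)))%N}.
Proof.
move=> mapM pM rM.
have n_gt0 : (0 < n)%N by exact: leq_ltn_trans sigma_lt_n.
have [z prim_z] := C_prim_root_exists n_gt0.
have [x0 x0E] := completion_of_zero_sum n_gt0 (fourier_mx_zero_sum prim_z sigma_lt_n).
have := rM _ _ prim_z; rewrite x0E => rx0.
have [x rx] := @rank_real_point R _ _ _ _ (fun F x => M F (completion_of x)) x0
  (fun F F' f x => etrans (congr1 (M F') (map_completion_of f x)) (mapM _ _ _ _))
  (pM algC) rx0.
case: iidG => indG lawG.
have atomless i E : finite_set E -> P (G i @^-1` E)%classic = 0%E.
  move=> fE; rewrite -(normal_prob_finite fE) -(lawG i)//.
  exact/countable_measurable/finite_set_countable.
exact: (ae_rank_ge indG atomless (pM R) rx).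
Qed.

Lemma ae_mds : {ae P, forall w, mds (H w)}.
Proof.
(* The finite functions form a finite type, so only finitely many almost sure events are
   intersected. *)
have : {ae P, forall w, forall f : {ffun 'I_sigma -> 'I_n}, injective f ->
    (sigma <= \rank (colsub f (H w)))%N}.
  apply: filter_forall => f.
  have [fi|nfi] := pselect (injective f); last by apply: aeW.
  apply: filterS (ae_completion_rank (r := sigma)
    (M := fun F A => colsub f A) _ _ _) => //.
  - by move=> F F' g A; rewrite map_mxsub.
  - by move=> F; apply: polymx_mxsub; exact: polymx_completion_of.
  - by move=> F z prim_z; rewrite mxrank_unit//; exact: fourier_mx_mds.
apply: filterS => w rk f fi.
have := rk (finfun f); rewrite mxsub_ffunr => rkf.
rewrite -row_free_unit /row_free eqn_leq rank_leq_row rkf// => t t'.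
by rewrite !ffunE => /fi.
Qed.

Lemma ae_independent_rows : {ae P, forall w, independent_rows (H w)}.
Proof.
apply: filter_forall => I.
have [cI|] := pselect (#|I| = (n - sigma)%N); last by move=> nI; apply: aeW.
apply: filterS (ae_completion_rank (r := n - sigma)
  (M := fun F A => rowsub (fun t : 'I_#|I| => enum_val t) (encoding A)) _ _ _) => //.
- by move=> F F' g A; rewrite map_encoding map_mxsub.
- by move=> F; apply: polymx_mxsub; apply: polymx_encoding; exact: polymx_completion_of.
- by move=> F z prim_z; exact: rank_encoding_fourier_mx.
Qed.

End AlmostSurelyGood.

(** * The algorithm *)

Lemma findDecoding_exists (R : realType) n k sigma (B : 'M[R]_(n, k)) :
  (sigma <= n)%N ->
  (forall I : {set 'I_n}, #|I| = (n - sigma)%N ->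
     ((const_mx 1 : 'rV[R]_k) <= rows_of B I)%MS) ->
  exists A, @findDecoding R n k sigma B A.
Proof.
move=> sn oneB; pose S := [set I : {set 'I_n} | #|I| == (n - sigma)%N].
have cS : 'C(n, sigma) = #|S| by rewrite card_draws card_ord bin_sub.
pose I (r : 'I_('C(n, sigma))) : {set 'I_n} := enum_val (cast_ord cS r).
have cI r : #|I r| = (n - sigma)%N.
  by have := enum_valP (cast_ord cS r); rewrite inE => /eqP.
(* Solutions are extended by zero to length [n], so that their type does not depend on [r] and
   choice applies. *)
have /choice[x xB] r : exists x : 'rV[R]_n,
    (forall j, j \notin I r -> x 0 j = 0) /\
    colsub (fun t : 'I_#|I r| => enum_val t) x *m rows_of B (I r) = const_mx 1.
  have /submxP[y yB] := oneB (I r) (cI r).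
  exists (\row_j if pselect (j \in I r) is left jI then y 0 (enum_rank_in jI j) else 0).
  split; first by move=> j jI; rewrite mxE; case: pselect => // jI'; rewrite jI' in jI.
  rewrite yB; congr (_ *m _); apply/rowP => t; rewrite !mxE.
  by case: pselect => [tI|]; rewrite ?enum_valK_in ?enum_valP.
exists (\matrix_(r, j) x r 0 j), I; split.
- by move=> r r' /enum_val_inj/cast_ord_inj.
- move=> N; split=> [cN|[r <-]//].
  have NS : N \in S by rewrite inE cN.
  exists (cast_ord (esym cS) (enum_rank_in NS N)).
  by rewrite /I cast_ordKV enum_rankK_in.
- move=> r; exists (colsub (fun t : 'I_#|I r| => enum_val t) (x r)).
  have [x0 x1] := xB r; split => // [t|j /x0 xj]; by rewrite !mxE.
Qed.

Lemma findDecoding_mul (R : realType) n k sigma (B : 'M[R]_(n, k)) A :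
  @findDecoding R n k sigma B A -> A *m B = const_mx 1.
Proof.
move=> [I [_ _ AI]]; apply/matrixP => r j; have [x [xB Ax A0]] := AI r.
have /matrixP/(_ 0 j) := xB; rewrite [RHS]mxE => E; rewrite [RHS]mxE -[RHS]E !mxE.
rewrite (bigID [in I r])/= [X in _ + X]big1 ?addr0; last first.
  by move=> l lI; rewrite A0// mul0r.
rewrite big_enum_val; apply: eq_bigr => t _.
by rewrite Ax mxE.
Qed.

Lemma findDecoding_supp (R : realType) n k sigma (B : 'M[R]_(n, k)) A
    (N : {set 'I_n}) : @findDecoding R n k sigma B A -> #|N| = (n - sigma)%N ->
  exists r, supp (row r A) \subset N.
Proof.
move=> [I [_ IP AI]] /IP[r <-]; exists r; have [x [_ _ A0]] := AI r.
by apply/fintype.subsetP => j; rewrite inE mxE; apply: contra_neqT => /A0.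
Qed.

(** * Correctness of the output for good draws *)

Section Deterministic.
Context (R : realType) (n : nat).
Hypothesis n_gt0 : (0 < n)%N.

Definition good sigma (H : 'M[R]_(sigma, n)) :=
  [/\ mds H, independent_rows H & H *m const_mx 1 = 0 :> 'cV[R]_sigma].

Lemma good_exists sigma (H : 'M[R]_(sigma, n)) : (sigma < n)%N -> good H ->
  exists (A : 'M[R]_('C(n, sigma), n)) (B : 'M[R]_n),
    determineCoef H B /\ findDecoding B A.
Proof.
move=> sn [uH iH H1]; have [B HB] := mds_determineCoef sn uH.
have [A BA] : exists A, @findDecoding R n n sigma B A.
  apply: findDecoding_exists; first exact: ltnW.
  exact: (ones_rows_determineCoef sn uH HB H1 iH).
by exists A, B.
Qed.

Lemma good_gradient_code sigma (H : 'M[R]_(sigma, n)) A B :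
  (sigma < n)%N -> good H -> determineCoef H B -> findDecoding B A ->
  @gradient_code R n n sigma A B.
Proof.
move=> sn [uH iH H1] HB BA; split.
- move=> I cI; split; first exact: (rank_rows_determineCoef sn HB iH).
  exact: (ones_rows_determineCoef sn uH HB H1 iH).
- move=> j; rewrite /norm0 (card_supp_determineCoef sn uH HB).
  by rewrite divff ?pnatr_eq0 -?lt0n// mul1r addn1.
- by move=> N cN; exact: findDecoding_supp BA cN.
- exact: findDecoding_mul BA.
Qed.

Lemma gradient_code0 : @gradient_code R n n 0 (const_mx 1) 1%:M.
Proof.
split.
- move=> I; rewrite subn0 => cI.
  have fI : row_free (rows_of (1%:M : 'M[R]_n) I).
    apply/row_freeP; exists (rows_of 1%:M I)^T.
    rewrite mul_rowsub_mx mul1mx; apply/matrixP => s t; rewrite !mxE.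
    by rewrite (inj_eq enum_val_inj) eq_sym.
  have rI : \rank (rows_of (1%:M : 'M[R]_n) I) = n by rewrite (eqP fI).
  by split => //; apply: submx_full; rewrite /row_full rI.
- move=> j; rewrite divff ?pnatr_eq0 -?lt0n// mul1r add0n ler_nat /norm0 card_gt0.
  by apply/set0Pn; exists j; rewrite inE !mxE eqxx oner_neq0.
(* A set of size [n] contains all indices, so the single row works. *)
- move=> N; rewrite subn0 => cN; have r : 'I_('C(n, 0)) by rewrite bin0; exact: ord0.
  exists r; apply/fintype.subsetP => j _.
  suff -> : N = [set: 'I_n] by rewrite finset.in_setT.
  by apply/eqP; rewrite eqEcard finset.subsetT finset.cardsT card_ord cN leqnn.
- by rewrite mulmx1.
Qed.

Lemma good_nested_gradient_code s (H : forall sigma, 'M[R]_(sigma, n)) A B :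
  (s < n)%N -> (forall sigma, (1 <= sigma <= s)%N -> good (H sigma)) ->
  algorithm_output s H A B -> nested_gradient_code s A B.
Proof.
move=> sn gH [B0 A0 AB]; split=> [[|sigma] ss|sigma ss i].
- by rewrite B0 A0; exact: gradient_code0.
- have [HB BA] := AB _ (ss : (1 <= sigma.+1 <= s)%N).
  by apply: good_gradient_code HB BA; [exact: leq_ltn_trans sn | exact: gH].
have sn' : (sigma.+1 < n)%N := leq_ltn_trans ss sn.
have [HB' _] := AB _ (ss : (1 <= sigma.+1 <= s)%N).
have [uH' _ _] := gH _ (ss : (1 <= sigma.+1 <= s)%N).
rewrite (supp_determineCoef sn' uH' HB').
(* [B 0] is the identity rather than an output of [determineCoef]; the support of its row [i] is the
   window of [i] reduced to shift 0. *)
case: sigma ss sn' {HB' uH'} => [|sigma] ss sn'.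
  rewrite B0; apply/fintype.subsetP => j; rewrite inE !mxE pnatr_eq0 eqb0 negbK => /eqP <-.
  by apply/imsetP; exists ord0.
have ss' : (1 <= sigma.+1 <= s)%N by exact: ltnW.
have [HB _] := AB _ ss'; have [uH _ _] := gH _ ss'.
rewrite (supp_determineCoef (ltnW sn') uH HB).
apply/fintype.subsetP => _ /imsetP[t _ ->]; apply/imsetP.
by exists (widen_ord (leqnSn _) t).
Qed.

Lemma good_algorithm_output s (H : forall sigma, 'M[R]_(sigma, n)) :
  (s < n)%N -> (forall sigma, (1 <= sigma <= s)%N -> good (H sigma)) ->
  exists A B, algorithm_output s H A B.
Proof.
move=> sn gH.
have AB sigma : exists AB : 'M[R]_('C(n, sigma), n) * 'M[R]_n,
    (sigma = 0 -> AB.2 = 1%:M /\ AB.1 = const_mx 1) /\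
    ((1 <= sigma <= s)%N -> determineCoef (H sigma) AB.2 /\ findDecoding AB.2 AB.1).
  have [/andP[s1 ss]|ns] := boolP (1 <= sigma <= s)%N; last first.
    (* These are the values prescribed for [sigma = 0], and a default for [sigma > s]. *)
    by exists (const_mx 1, 1%:M).
  have [|A [B HAB]] := @good_exists sigma (H sigma) (leq_ltn_trans ss sn).
    by apply: gH; rewrite s1.
  by exists (A, B); split => // s0; rewrite s0 in s1.
pose F sigma := projT1 (cid (AB sigma)).
have FP sigma := projT2 (cid (AB sigma)).
exists (fun sigma => (F sigma).1), (fun sigma => (F sigma).2); split.
- by have [/(_ erefl)[]] := FP 0%N.
- by have [/(_ erefl)[]] := FP 0%N.
- by move=> sigma /((FP sigma).2).
Qed.

End Deterministic.

(** As the subroutines are relations, the existence of an output is claimed too: it says that almost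
    surely the algorithm succeeds, so that the claim on all outputs is not vacuous. *)
Theorem lemma1 (R : realType) (d : measure_display) (T : measurableType d)
    (P : probability T R) (n s : nat)
    (G : forall sigma : nat, 'I_sigma * 'I_n.-1 -> {RV P >-> R})
    (hn : (1 <= n)%N) (hs : (s <= n - 1)%N)
    (hG : forall sigma : nat, (1 <= sigma <= s)%N ->
       iid_standard_normal (G sigma)) :
  let H (w : T) (sigma : nat) : 'M[R]_(sigma, n) :=
    zero_sum_completion (\matrix_(i, j) G sigma (i, j) w) in
  {ae P, forall w,
    (exists A B, algorithm_output s (H w) A B) /\
    (forall A B, algorithm_output s (H w) A B ->
       nested_gradient_code s A B)}.
Proof.
move=> H.
have sn : (s < n)%N by rewrite (leq_ltn_trans hs)// subn1 prednK.
have : {ae P, forall w, forall sigma, (1 <= sigma <= s)%N -> good (H w sigma)}.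
  apply: ae_foralln => sigma.
  have [/andP[s1 ss]|ns] := boolP (1 <= sigma <= s)%N; last by apply: aeW.
  have sn' : (sigma < n)%N := leq_ltn_trans ss sn.
  have iidG : iid_standard_normal (G sigma) by apply: hG; rewrite s1.
  apply: filterS2 (ae_mds sn' iidG) (ae_independent_rows sn' iidG) => w uH iH _.
  by split => //; exact: completion_zero_sum.
apply: filterS => w gH; split; first exact: good_algorithm_output.
by move=> A B; exact: good_nested_gradient_code.
Qed.
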